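(* The statistical mirror of a Kähler tube domain of constant holomorphic sectional curvature need not have constant scalar curvature. Specifically, let $$\Omega=\{(\theta^1,\theta^2)\in\mathbb{R}^2: e^{\theta^1}+e^{\theta^2}<1\},\qquad \Phi(\theta)=-\log\big(1-e^{\theta^1}-e^{\theta^2}\big),$$ with Legendre dual $$\Phi^\ast(\eta)=\eta_1\log\eta_1+\eta_2\log\eta_2-(1+\eta_1+\eta_2)\log(1+\eta_1+\eta_2)$$ on $\Omega^\ast=\{(\eta_1,\eta_2):\eta_1,\eta_2>0\}$. Then $(T\Omega,G_\Phi)$ has constant negative holomorphic sectional curvature, while the scalar curvature of $(T\Omega^\ast,G_{\Phi^\ast})$ is negative but not constant.
   Context: For a domain $U\subset\mathbb{R}^n$, $TU=\{x+\sqrt{-1}\,y: x\in U,\ y\in\mathbb{R}^n\}\subset\mathbb{C}^n$. For smooth $\Phi:U\to\mathbb{R}$ with positive definite Hessian, $G_\Phi=\sum_{i,j}\frac{\partial^2\Phi}{\partial x^i\partial x^j}(x)(dx^idx^j+dy^idy^j)$ is the induced Kähler metric on $TU$. The Legendre dual is $\Phi^\ast(u)=\sup_{x\in U}(\langle x,u\rangle-\Phi(x))$ on the domain $U^\ast=D\Phi(U)$, and $(TU^\ast,G_{\Phi^\ast})$ is called the statistical mirror of $(TU,G_\Phi)$. (Here $\Phi$ is the log-partition function of the exponential family of negative trinomial distributions in natural parameters $\theta^i=\log p_i$.) *)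

(* Defs.v *)
From HB Require Import structures.
From mathcomp Require Import all_boot all_order all_algebra.
From mathcomp Require Import all_classical all_reals all_analysis.

Set Implicit Arguments.
Unset Strict Implicit.
Unset Printing Implicit Defensive.

Import Order.TTheory GRing.Theory Num.Theory.
Import numFieldNormedType.Exports.

Local Open Scope classical_set_scope.
Local Open Scope ring_scope.

Section Calculus.
Context {R : realType} {n : nat}.
Implicit Types (U : set 'rV[R]_n) (f : 'rV[R]_n -> R).

Definition partial (i : 'I_n) f (x : 'rV[R]_n) : R := 'D_(delta_mx 0 i) f x.

Definition iter_partial (s : seq 'I_n) f : 'rV[R]_n -> R := foldr partial f s.

Definition domain U := [/\ open U, connected U & U !=set0].

(* [derivable] is required separately because 'D_v f x is a total function. *)
Definition smooth_on U f := forall (s : seq 'I_n) (x : 'rV[R]_n), U x ->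
  {for x, continuous (iter_partial s f)} /\
  forall i : 'I_n, derivable (iter_partial s f) x (delta_mx 0 i).

Definition gradient f (x : 'rV[R]_n) : 'rV[R]_n := \row_i partial i f x.

Definition hessian f (x : 'rV[R]_n) : 'M[R]_n :=
  \matrix_(i, j) partial i (partial j f) x.

Definition dotv (u v : 'rV[R]_n) : R := \sum_i u 0 i * v 0 i.

Definition bilin (A : 'M[R]_n) (u v : 'rV[R]_n) : R :=
  \sum_i \sum_j A i j * u 0 i * v 0 j.

Definition posdef (A : 'M[R]_n) :=
  A^T = A /\ forall v : 'rV[R]_n, v != 0 -> 0 < bilin A v v.

End Calculus.

(* Curvature, in coordinates, of a Riemannian metric g on an open subset
   of R^N; Gram matrices g z have entries g(d_i, d_j). *)
Section Riemannian.
Context {R : realType} {N : nat}.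
Implicit Types (g : 'rV[R]_N -> 'M[R]_N) (z X Y : 'rV[R]_N).

(* christoffel g k i j is Gamma^k_{ij} of the Levi-Civita connection. *)
Definition christoffel g (k i j : 'I_N) z : R :=
  2^-1 * \sum_l invmx (g z) k l *
    (partial i (fun w => g w j l) z + partial j (fun w => g w i l) z
     - partial l (fun w => g w i j) z).

(* R(d_i, d_j) d_k = \sum_l riemann g l k i j d_l, for the convention
   R(X, Y) Z = D_X D_Y Z - D_Y D_X Z - D_[X, Y] Z. *)
Definition riemann g (l k i j : 'I_N) z : R :=
  partial i (christoffel g l j k) z - partial j (christoffel g l i k) z
  + \sum_m (christoffel g l i m z * christoffel g m j k z
            - christoffel g l j m z * christoffel g m i k z).

Definition curvature_op g z X Y (Z : 'rV[R]_N) : 'rV[R]_N :=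
  \row_l \sum_i \sum_j \sum_k riemann g l k i j z * X 0 i * Y 0 j * Z 0 k.

Definition sectional g z X Y : R :=
  bilin (g z) (curvature_op g z X Y Y) X /
  (bilin (g z) X X * bilin (g z) Y Y - bilin (g z) X Y ^+ 2).

(* Ric(Y, Z) is the trace of X |-> R(X, Y) Z. *)
Definition ricci g (j k : 'I_N) z : R := \sum_i riemann g i k i j z.

Definition scalar_curvature g z : R :=
  \sum_j \sum_k invmx (g z) j k * ricci g j k z.

End Riemannian.

(* C^n is identified with R^(n+n), x + iy being row_mx x y. *)
Section Tube.
Context {R : realType} {n : nat}.
Implicit Types (U : set 'rV[R]_n) (Phi : 'rV[R]_n -> R).

Definition tube U : set 'rV[R]_(n + n) := [set z | U (lsubmx z)].

(* Multiplication by the imaginary unit. *)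
Definition cplx_J (X : 'rV[R]_(n + n)) : 'rV[R]_(n + n) :=
  row_mx (- rsubmx X) (lsubmx X).

Definition tube_metric Phi (z : 'rV[R]_(n + n)) : 'M[R]_(n + n) :=
  block_mx (hessian Phi (lsubmx z)) 0 0 (hessian Phi (lsubmx z)).

(* The pairs (U, Phi) for which (TU, G_Phi) is a Kaehler tube domain. *)
Definition kahler_tube U Phi :=
  [/\ domain U, smooth_on U Phi & forall x, U x -> posdef (hessian Phi x)].

Definition holo_sectional Phi (z X : 'rV[R]_(n + n)) : R :=
  sectional (tube_metric Phi) z X (cplx_J X).

Definition has_holo_sectional U Phi (c : R) :=
  forall z X : 'rV[R]_(n + n), tube U z -> X != 0 -> holo_sectional Phi z X = c.

Definition tube_scalar Phi (z : 'rV[R]_(n + n)) : R :=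
  scalar_curvature (tube_metric Phi) z.

Definition has_const_scalar U Phi :=
  exists c : R, forall z : 'rV[R]_(n + n), tube U z -> tube_scalar Phi z = c.

Definition dual_domain U Phi : set 'rV[R]_n := gradient Phi @` U.

Definition legendre U Phi (u : 'rV[R]_n) : \bar R :=
  ereal_sup [set (dotv x u - Phi x)%:E | x in U].

(* Real-valued potential; [fine] is harmless where [legendre] is finite, which
   is the case on [dual_domain U Phi] when U and Phi are convex. *)
Definition dual_potential U Phi (u : 'rV[R]_n) : R := fine (legendre U Phi u).

End Tube.

Section NegativeTrinomial.
Context {R : realType}.

Definition Omega : set 'rV[R]_2 :=
  [set t | expR (t 0 0) + expR (t 0 1) < 1].

Definition PhiNT (t : 'rV[R]_2) : R :=
  - ln (1 - expR (t 0 0) - expR (t 0 1)).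

Definition OmegaStar : set 'rV[R]_2 := [set u | 0 < u 0 0 /\ 0 < u 0 1].

Definition PhiNTStar (u : 'rV[R]_2) : R :=
  u 0 0 * ln (u 0 0) + u 0 1 * ln (u 0 1)
  - (1 + u 0 0 + u 0 1) * ln (1 + u 0 0 + u 0 1).

End NegativeTrinomial.
Arguments Omega : clear implicits.
Arguments OmegaStar : clear implicits.

(* Main.v *)
Require Import Defs.
From mathcomp Require Import all_boot all_order all_algebra.
From mathcomp Require Import ring lra.
From mathcomp Require Import all_classical all_reals all_analysis.
Import Order.TTheory GRing.Theory Num.Theory.
Import numFieldNormedType.Exports.
Local Open Scope classical_set_scope.
Local Open Scope ring_scope.

(** Coordinates on a tube split as x + iy, and the metric G_Phi is two copies
    of the Hessian of Phi, with coefficients depending on x only.  If gam is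
    half the Hessian-raised third derivative of Phi, the Christoffel symbols
    of G_Phi are gam times the structure constants of the complex numbers
    over the reals ([christoffel_tube]).  Everything about the curvature of
    the tube is thus read off gam and its derivatives on the base
    ([riemann_tube]); in particular the scalar curvature is
    -2 H^{jk} d_j gam^i_{ik}, which is minus the H-trace of the Hessian of
    log det H ([tube_scalarE]).

    For the negative trinomial family let eta = p / (1 - p_1 - p_2) be the
    mean and s = 1 + eta_1 + eta_2.  The Hessian of Phi is the covariance
    matrix eta_i delta_ij + eta_i eta_j, and d_l eta_i is an entry of the same
    matrix.  Hence gam is affine in eta, its derivative is a combination of
    deltas and entries of H, and the curvature tensor is the one of complex
    hyperbolic space: R(X, JX)JX = -|X|^2 X, so the holomorphic sectional
    curvature is -1 ([holo_sectional_hyperbolic], [holo_sectional_PhiNT]).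

    The gradient map is a bijection from Omega onto the open quadrant, with
    inverse eta |-> log (eta / s), and the Legendre dual is computed from
    log x <= x - 1 ([legendre_PhiNT]).  The Hessian of the dual is the inverse
    matrix delta_ij / eta_i - 1 / s, of determinant 1 / (s eta_1 eta_2), and
    the scalar curvature of the mirror is
    -(3 - 1/s + 1/eta_1 + 1/eta_2) ([scalar_mirror]): it is negative because
    s > 1, and its values at eta = (1, 1) and eta = (2, 2) differ. *)

(** * Directional derivatives and smoothness of elementary functions *)

Section PartialDerivatives.
Context {R : realType} {n : nat}.
Implicit Types (U : set 'rV[R]_n) (f g : 'rV[R]_n -> R) (x v : 'rV[R]_n).

(** A directional derivative is an ordinary derivative along a line; this
    brings the one-variable chain rule to functions of several variables. *)
Lemma is_derive_line f x v (d : R) :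
  is_derive (0 : R) 1 (fun h : R => f (h *: v + x)) d <-> is_derive x v f d.
Proof.
have E : 'D_1 (fun h : R => f (h *: v + x)) 0 = 'D_v f x.
  rewrite /derive; apply: (congr1 (fun F : R -> R => lim (F @ 0^'))).
  apply/funext => h /=.
  by rewrite addr0 scale0r add0r [_%:A]mulr1.
split=> -[df dv]; split.
- by rewrite (derivable1P f).
- by rewrite -E.
- by rewrite -(derivable1P f).
- by rewrite E.
Qed.

Lemma is_derive_chain f (g : R -> R) x v (df dg : R) :
  is_derive x v f df -> is_derive (f x) 1 g dg ->
  is_derive x v (fun y => g (f y)) (dg * df).
Proof.
move=> /is_derive_line hf hg; apply/is_derive_line.
apply: (@is_derive1_comp _ g (fun h : R => f (h *: v + x))).
by rewrite scale0r add0r.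
Qed.

Lemma is_derive_add f g x v (df dg : R) : is_derive x v f df ->
  is_derive x v g dg -> is_derive x v (fun y => f y + g y) (df + dg).
Proof. by move=> hf hg; apply: is_deriveD. Qed.

Lemma is_derive_opp f x v (df : R) : is_derive x v f df ->
  is_derive x v (fun y => - f y) (- df).
Proof. by move=> hf; apply: is_deriveN. Qed.

Lemma is_derive_mul f g x v (df dg : R) : is_derive x v f df ->
  is_derive x v g dg ->
  is_derive x v (fun y => f y * g y) (f x * dg + g x * df).
Proof. by move=> hf hg; apply: is_deriveM. Qed.

Lemma is_derive_inv f x v (df : R) : f x != 0 -> is_derive x v f df ->
  is_derive x v (fun y => (f y)^-1) (- (f x) ^- 2 * df).
Proof.
move=> fx0 [hf <-]; split; first exact: derivableV.
by rewrite deriveV.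
Qed.

Lemma is_derive_const (c : R) x v : is_derive x v (fun=> c) 0.
Proof. exact: is_derive_cst. Qed.

Lemma is_derive_coord (i j : 'I_n) x :
  is_derive x (delta_mx 0 i) (fun y => y 0 j) (i == j)%:R.
Proof.
apply/is_derive_line.
have -> : (fun h : R => (h *: delta_mx 0 i + x) 0 j) =
    (fun h : R => (i == j)%:R * h + x 0 j).
  by apply/funext => h; rewrite !mxE eqxx mulrC eq_sym.
have -> : (i == j)%:R = (i == j)%:R * 1 + 1 * 0 + 0 :> R.
  by rewrite mulr1 mulr0 !addr0.
apply: is_deriveD; rewrite mulr1 mul1r addr0.
apply: (is_derive_eq (is_deriveM (is_derive_cst _ _ _) (is_derive_id _ _))).
by rewrite scaler0 addr0 [LHS]mulr1.
Qed.

Lemma is_derive_near U f g x v (d : R) : open U -> U x ->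
  (forall y, U y -> f y = g y) -> is_derive x v f d -> is_derive x v g d.
Proof.
move=> oU Ux fg; apply: near_eq_is_derive.
by apply: filterS (open_nbhs_nbhs (conj oU Ux)).
Qed.

Lemma partial_near U f g i x : open U -> U x ->
  (forall y, U y -> f y = g y) -> partial i f x = partial i g x.
Proof.
move=> oU Ux fg; apply: near_eq_derive.
by apply: filterS (open_nbhs_nbhs (conj oU Ux)).
Qed.

Lemma partialE f i x (d : R) : is_derive x (delta_mx 0 i) f d ->
  partial i f x = d.
Proof. by case. Qed.

(** The closure of constants and coordinates under the operations that occur
    in the two potentials.  The domain conditions are imposed on U only, and
    make the class stable under partial derivatives on U, so that smoothness
    follows by induction on the number of derivatives. *)
Inductive elementary U : ('rV[R]_n -> R) -> Prop :=
| ElemConst c : elementary U (fun=> c)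
| ElemCoord i : elementary U (fun x => x 0 i)
| ElemAdd f g : elementary U f -> elementary U g ->
    elementary U (fun x => f x + g x)
| ElemOpp f : elementary U f -> elementary U (fun x => - f x)
| ElemMul f g : elementary U f -> elementary U g ->
    elementary U (fun x => f x * g x)
| ElemInv f : (forall x, U x -> f x != 0) -> elementary U f ->
    elementary U (fun x => (f x)^-1)
| ElemExp f : elementary U f -> elementary U (fun x => expR (f x))
| ElemLn f : (forall x, U x -> 0 < f x) -> elementary U f ->
    elementary U (fun x => ln (f x)).

Lemma elementary_continuous U f : elementary U f ->
  forall x, U x -> {for x, continuous f}.
Proof.
move=> ef x Ux; elim: ef => {f}.
- by move=> c; exact: cst_continuous.
- by move=> i; exact: coord_continuous.
- by move=> f g _ hf _ hg; exact: (continuousD hf hg).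
- by move=> f _ hf; exact: (continuousN hf).
- by move=> f g _ hf _ hg; exact: (continuousM hf hg).
- by move=> f f0 _ hf; apply: continuousV => //; exact: f0.
- by move=> f _ hf; apply: (continuous_comp hf); exact: continuous_expR.
- move=> f f0 _ hf; apply: (continuous_comp hf).
  by apply: continuous_ln; exact: f0.
Qed.

Lemma elementary_partial U f i : elementary U f ->
  exists2 g, elementary U g &
    forall x, U x -> is_derive x (delta_mx 0 i) f (g x).
Proof.
elim=> {f}.
- by move=> c; exists (fun=> 0); [constructor|move=> *; exact: is_derive_const].
- move=> j; exists (fun=> (i == j)%:R); first by constructor.
  by move=> *; exact: is_derive_coord.
- move=> f g _ [f' ef' hf] _ [g' eg' hg]; exists (fun x => f' x + g' x).
    exact: ElemAdd.
  by move=> x Ux; apply: is_derive_add; [exact: hf|exact: hg].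
- move=> f _ [f' ef' hf]; exists (fun x => - f' x); first exact: ElemOpp.
  by move=> x Ux; apply: is_derive_opp; exact: hf.
- move=> f g ef [f' ef' hf] eg [g' eg' hg].
  exists (fun x => f x * g' x + g x * f' x).
    by apply: ElemAdd; apply: ElemMul.
  by move=> x Ux; apply: is_derive_mul; [exact: hf|exact: hg].
- move=> f f0 ef [f' ef' hf]; exists (fun x => - (f x * f x)^-1 * f' x).
    apply: ElemMul => //; apply: ElemOpp; apply: ElemInv; last exact: ElemMul.
    by move=> x Ux; rewrite mulf_neq0 ?f0.
  by move=> x Ux; apply: is_derive_inv; [exact: f0|exact: hf].
- move=> f ef [f' ef' hf]; exists (fun x => expR (f x) * f' x).
    by apply: ElemMul => //; exact: ElemExp.
  move=> x Ux; apply: is_derive_chain; exact: hf.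
- move=> f f0 ef [f' ef' hf]; exists (fun x => (f x)^-1 * f' x).
    apply: ElemMul => //; apply: ElemInv => // x Ux.
    by rewrite gt_eqF ?f0.
  move=> x Ux; apply: is_derive_chain; first exact: hf.
  by apply: is_derive1_ln; exact: f0.
Qed.

Lemma continuous_eq_open U f g x : open U -> U x ->
  (forall y, U y -> f y = g y) ->
  {for x, continuous f} -> {for x, continuous g}.
Proof.
move=> oU Ux fg cf; rewrite /prop_for /continuous_at -fg //.
apply: cvg_trans cf; apply: (@near_eq_cvg _ _ (nbhs x)).
by apply: filterS (open_nbhs_nbhs (conj oU Ux)) => y Uy; rewrite fg.
Qed.

Lemma smooth_on_eq U f g : open U -> (forall x, U x -> f x = g x) ->
  smooth_on U f -> smooth_on U g.
Proof.
move=> oU fg sf s.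
have E : forall x, U x -> iter_partial s f x = iter_partial s g x.
  elim: s => [|i s IH] x Ux /=; first exact: fg.
  exact: (partial_near U).
move=> x Ux; have [cf df] := sf s x Ux; split.
  exact: (continuous_eq_open U _ _ x oU Ux E).
move=> i; apply: near_eq_derivable (df i).
by apply: filterS (open_nbhs_nbhs (conj oU Ux)).
Qed.

Lemma elementary_smooth U f : open U -> elementary U f -> smooth_on U f.
Proof.
move=> oU ef s.
have [g eg fg] : exists2 g, elementary U g &
    forall x, U x -> g x = iter_partial s f x.
  elim: s => [|i s [g eg fg]]; first by exists f.
  have [g' eg' hg'] := elementary_partial U g i eg.
  exists g' => // x Ux; rewrite /= -(partial_near U g) //.
  exact/esym/partialE/hg'.
move=> x Ux; split.
  apply: (continuous_eq_open U g _ x oU Ux fg).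
  exact: (elementary_continuous U).
move=> i; have [g' _ hg'] := elementary_partial U g i eg.
have [] // : is_derive x (delta_mx 0 i) (iter_partial s f) (g' x).
exact: (is_derive_near U g) (hg' x Ux).
Qed.

End PartialDerivatives.

(** * Curvature of a tube in terms of its base *)

Section TubeCurvature.
Context {R : realType} {n : nat}.
Implicit Types (U : set 'rV[R]_n) (f : 'rV[R]_n -> R).
Implicit Types (z X Y : 'rV[R]_(n + n)) (a b c d e : bool) (i j k l : 'I_n).

(** The boolean tells real coordinates (false) from imaginary ones (true), so
    that addition of types of coordinates is exclusive or. *)
Definition idx a i : 'I_(n + n) := if a then rshift n i else lshift n i.
Arguments idx a i : simpl never.

Definition part a X : 'rV[R]_n := if a then rsubmx X else lsubmx X.
Arguments part a X : simpl never.

Lemma partE a X i : X 0 (idx a i) = part a X 0 i.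
Proof. by rewrite /idx /part; case: a; rewrite mxE. Qed.

Lemma part_eq X Y : (forall a, part a X = part a Y) -> X = Y.
Proof.
by move=> h; rewrite -(hsubmxK X) -(hsubmxK Y) (h false : lsubmx X = lsubmx Y)
  (h true : rsubmx X = rsubmx Y).
Qed.

Lemma sum_idx (F : 'I_(n + n) -> R) :
  \sum_p F p = \sum_i F (idx false i) + \sum_i F (idx true i).
Proof. by rewrite big_split_ord. Qed.

Lemma tube_open U : open U -> open (tube U).
Proof.
move=> oU; apply: (@open_comp _ _ (@lsubmx R 1 n n) U) => // z _.
exact/differentiable_continuous/differentiable_lsubmx.
Qed.

Lemma partial_lsubmx f a i z :
  partial (idx a i) (fun w => f (lsubmx w)) z =
  (~~ a)%:R * partial i f (lsubmx z).
Proof.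
rewrite /idx; case: a; rewrite /= ?mul0r ?mul1r.
  rewrite -[RHS](derive_cst (f (lsubmx z)) z (delta_mx 0 (rshift n i))).
  rewrite /partial /derive; apply: (congr1 (fun F : R -> R => lim (F @ 0^'))).
  apply/funext => h /=; congr (_ *: (f _ - _)).
  by apply/rowP => j; rewrite !mxE eq_lrshift andbF mulr0 add0r.
rewrite /partial /derive; apply: (congr1 (fun F : R -> R => lim (F @ 0^'))).
apply/funext => h /=; congr (_ *: (f _ - _)).
by apply/rowP => j; rewrite !mxE eq_lshift.
Qed.

(** The equality of F with a function of the real part is only required on
    the tube, which is open: derivatives are local. *)
Lemma partial_tube U (F : 'rV[R]_(n + n) -> R) f (df : R) a i z :
  open U -> tube U z -> (forall w, tube U w -> F w = f (lsubmx w)) ->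
  is_derive (lsubmx z) (delta_mx 0 i) f df ->
  partial (idx a i) F z = (~~ a)%:R * df.
Proof.
move=> oU Uz Ff [_ <-].
rewrite (partial_near _ _ (fun w => f (lsubmx w)) _ _ (tube_open _ oU)) //.
exact: partial_lsubmx.
Qed.

Lemma tube_metricE Phi a b i j z :
  tube_metric Phi z (idx a i) (idx b j) =
  (a == b)%:R * hessian Phi (lsubmx z) i j.
Proof.
rewrite /tube_metric /idx; case: a b => -[] /=; rewrite ?mul1r ?mul0r.
- by rewrite block_mxEdr.
- by rewrite block_mxEdl mxE.
- by rewrite block_mxEur mxE.
- by rewrite block_mxEul.
Qed.

Lemma invmx_tube_metricE Phi a b i j z :
  hessian Phi (lsubmx z) \in unitmx ->
  invmx (tube_metric Phi z) (idx a i) (idx b j) =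
  (a == b)%:R * invmx (hessian Phi (lsubmx z)) i j.
Proof.
move=> uH; rewrite /tube_metric invmx_block_diag ?block_diag_mx_unit ?uH //.
rewrite /idx; case: a b => -[] /=; rewrite ?mul1r ?mul0r.
- by rewrite block_mxEdr.
- by rewrite block_mxEdl mxE.
- by rewrite block_mxEur mxE.
- by rewrite block_mxEul.
Qed.

(** Structure constants of the complex numbers: with e_false = 1 and
    e_true = i, the coefficient of e_c in the product e_a e_b. *)
Definition cplx_coef a b c : R := (c == a (+) b)%:R * (-1) ^+ (a && b).

(** The symmetry of T in its first two indices is what makes the Hessian
    metric Kaehler; it is the symmetry of third derivatives of Phi. *)
Definition third_derivatives U (Phi : 'rV[R]_n -> R)
    (T : 'I_n -> 'I_n -> 'I_n -> 'rV[R]_n -> R) :=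
  forall x, U x ->
  [/\ hessian Phi x \in unitmx,
      forall l i j, partial l (fun y => hessian Phi y i j) x = T l i j x,
      forall l i j, T l i j x = T i l j x
    & forall l i j, T l i j x = T l j i x].

(** The Levi-Civita connection of the Hessian metric on the base. *)
Definition gamma_of (Phi : 'rV[R]_n -> R)
    (T : 'I_n -> 'I_n -> 'I_n -> 'rV[R]_n -> R) k i j x : R :=
  2^-1 * \sum_l invmx (hessian Phi x) k l * T l i j x.

Section Potential.
Variables (U : set 'rV[R]_n) (Phi : 'rV[R]_n -> R).
Variables (gam : 'I_n -> 'I_n -> 'I_n -> 'rV[R]_n -> R).
Variables (T : 'I_n -> 'I_n -> 'I_n -> 'rV[R]_n -> R).
Variables (D : 'I_n -> 'I_n -> 'I_n -> 'I_n -> 'rV[R]_n -> R).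
Hypothesis oU : open U.
Hypothesis hT : third_derivatives U Phi T.
Hypothesis hgam : forall x, U x -> forall k i j,
  gam k i j x = gamma_of Phi T k i j x.
Hypothesis hD : forall x, U x -> forall m k i j,
  is_derive x (delta_mx 0 m) (gam k i j) (D m k i j x).

(** Only derivatives along real coordinates survive in the Koszul formula,
    and by the symmetry of T the surviving terms are all equal up to sign.
    The signs are those of complex multiplication, since the connection of a
    Kaehler metric is complex linear. *)
Lemma christoffel_tube a b c k i j z : tube U z ->
  christoffel (tube_metric Phi) (idx c k) (idx a i) (idx b j) z =
  cplx_coef a b c * gam k i j (lsubmx z).
Proof.
move=> Uz; have [uH dH T12 T23] := hT _ Uz.
have dg a' b' c' i' j' k' :
    partial (idx a' i') (fun w => tube_metric Phi w (idx b' j') (idx c' k')) z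
    = (~~ a')%:R * (b' == c')%:R * T i' j' k' (lsubmx z).
  under eq_fun do rewrite tube_metricE.
  rewrite (partial_lsubmx (fun x => (b' == c')%:R * hessian Phi x j' k')).
  case: (b' == c'); last first.
    under eq_fun do rewrite mul0r.
    by rewrite /partial derive_cst !mulr0 mul0r.
  under eq_fun do rewrite mul1r.
  by rewrite dH mulr1.
rewrite hgam // /christoffel /gamma_of mulrCA; congr (_ * _).
rewrite sum_idx mulr_sumr -big_split; apply: eq_bigr => l _ /=.
rewrite !invmx_tube_metricE // !dg.
rewrite [T j i l _]T12 [T i j l _]T23 [T i l j _]T12.
by rewrite /cplx_coef; case: a; case: b; case: c => /=; ring.
Qed.

(** The coefficient of the quadratic terms is that of e_d in e_a e_b e_c; it
    is symmetric in a and b, which is why both quadratic terms share it. *)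
Lemma riemann_tube a b c d i j k l z : tube U z ->
  riemann (tube_metric Phi) (idx d l) (idx c k) (idx a i) (idx b j) z =
  (~~ a)%:R * cplx_coef b c d * D i l j k (lsubmx z)
  - (~~ b)%:R * cplx_coef a c d * D j l i k (lsubmx z)
  + (cplx_coef a false d * cplx_coef b c false
     + cplx_coef a true d * cplx_coef b c true) *
    \sum_m (gam l i m (lsubmx z) * gam m j k (lsubmx z)
          - gam l j m (lsubmx z) * gam m i k (lsubmx z)).
Proof.
move=> Uz.
have dG a' b' c' d' i' j' k' l' :
    partial (idx a' i')
      (christoffel (tube_metric Phi) (idx d' l') (idx b' j') (idx c' k')) z
    = (~~ a')%:R * cplx_coef b' c' d' * D i' l' j' k' (lsubmx z).
  rewrite -mulrA; apply: (partial_tube U _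
    (fun x => cplx_coef b' c' d' * gam l' j' k' x)) => //.
    by move=> w Uw; rewrite christoffel_tube.
  have := is_derive_mul _ _ _ _ _ _
    (is_derive_const (cplx_coef b' c' d') (lsubmx z) _) (hD _ Uz i' l' j' k').
  by rewrite mulr0 addr0.
rewrite /riemann !dG; congr (_ + _).
rewrite sum_idx mulr_sumr -big_split; apply: eq_bigr => m _ /=.
rewrite !christoffel_tube //.
by rewrite /cplx_coef; case: a; case: b; case: c; case: d => /=; ring.
Qed.

(** Adding the real-real and the imaginary-imaginary Ricci terms cancels all
    products of gam, and leaves the derivative of the trace of gam, which is
    half the logarithmic derivative of det (Hessian of Phi). *)
Lemma tube_scalarE z : tube U z ->
  tube_scalar Phi z =
  - 2 * \sum_j \sum_k invmx (hessian Phi (lsubmx z)) j k *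
                      \sum_i D j i i k (lsubmx z).
Proof.
move=> Uz; have [uH _ _ _] := hT _ Uz.
have ric j k : ricci (tube_metric Phi) (idx false j) (idx false k) z +
    ricci (tube_metric Phi) (idx true j) (idx true k) z =
    - 2 * \sum_i D j i i k (lsubmx z).
  rewrite /ricci !sum_idx mulr_sumr -!big_split /=; apply: eq_bigr => i _.
  by rewrite !riemann_tube // /cplx_coef /=; ring.
rewrite /tube_scalar /scalar_curvature sum_idx mulr_sumr -big_split /=.
apply: eq_bigr => j _.
rewrite !sum_idx mulr_sumr -!big_split /=; apply: eq_bigr => k _.
rewrite !invmx_tube_metricE //= mulrCA -ric; ring.
Qed.

End Potential.

Lemma bilin_sym (A : 'M[R]_n) u v : A^T = A -> bilin A u v = bilin A v u.
Proof.
move=> sA; rewrite /bilin exchange_big; apply: eq_bigr => i _.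
by apply: eq_bigr => j _; rewrite -{1}sA mxE mulrAC.
Qed.

Lemma bilinNl (A : 'M[R]_n) u v : bilin A (- u) v = - bilin A u v.
Proof.
rewrite /bilin -sumrN; apply: eq_bigr => i _.
by rewrite -sumrN; apply: eq_bigr => j _; rewrite mxE mulrN mulNr.
Qed.

Lemma bilinNr (A : 'M[R]_n) u v : bilin A u (- v) = - bilin A u v.
Proof.
rewrite /bilin -sumrN; apply: eq_bigr => i _.
by rewrite -sumrN; apply: eq_bigr => j _; rewrite mxE mulrN.
Qed.

Lemma bilinZl (A : 'M[R]_n) (t : R) u v : bilin A (t *: u) v = t * bilin A u v.
Proof.
rewrite /bilin mulr_sumr; apply: eq_bigr => i _.
by rewrite mulr_sumr; apply: eq_bigr => j _; rewrite mxE; ring.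
Qed.

Lemma bilin_tube Phi z X Y : bilin (tube_metric Phi z) X Y =
  bilin (hessian Phi (lsubmx z)) (part false X) (part false Y) +
  bilin (hessian Phi (lsubmx z)) (part true X) (part true Y).
Proof.
rewrite {1}/bilin sum_idx; congr (_ + _); apply: eq_bigr => i _.
all: rewrite sum_idx -big_split; apply: eq_bigr => j _ /=.
all: by rewrite !tube_metricE !partE /=; ring.
Qed.

Lemma part_cplx_J a X :
  part a (cplx_J X) = if a then part false X else - part true X.
Proof. by case: a; rewrite /cplx_J /part /= ?row_mxKr ?row_mxKl. Qed.

(** The curvature components of complex hyperbolic space are combinations of
    products of one delta and one entry of the metric; contracting them with
    vectors gives back the vectors and values of the metric. *)
Lemma contract_delta (A : 'M[R]_n) (u v w : 'rV[R]_n) (p q r : R) l :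
  A^T = A ->
  \sum_i \sum_j \sum_k (p * ((l == i)%:R * A j k) + q * ((l == j)%:R * A i k)
    + r * ((l == k)%:R * A i j)) * u 0 i * v 0 j * w 0 k =
  p * u 0 l * bilin A v w + q * v 0 l * bilin A u w + r * w 0 l * bilin A u v.
Proof.
move=> sA.
have pick (F : 'I_n -> R) : \sum_i (l == i)%:R * F i = F l.
  rewrite (bigD1 l) //= eqxx mul1r big1 ?addr0 // => i /negPf.
  by rewrite eq_sym => ->; rewrite mul0r.
transitivity (\sum_i (l == i)%:R * (p * u 0 i * bilin A v w) +
  \sum_j (l == j)%:R * (q * v 0 j * bilin A u w) +
  \sum_k (l == k)%:R * (r * w 0 k * bilin A u v)); last by rewrite !pick.
transitivity (\sum_i \sum_j \sum_k (l == i)%:R * p * u 0 i * (A j k * v 0 j * w 0 k)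
  + \sum_i \sum_j \sum_k (l == j)%:R * q * v 0 j * (A i k * u 0 i * w 0 k)
  + \sum_i \sum_j \sum_k (l == k)%:R * r * w 0 k * (A i j * u 0 i * v 0 j)).
  rewrite -!big_split; apply: eq_bigr => i _; rewrite -!big_split.
  apply: eq_bigr => j _; rewrite -!big_split; apply: eq_bigr => k _ /=; ring.
congr (_ + _ + _).
- apply: eq_bigr => i _; rewrite /bilin !mulrA mulr_sumr; apply: eq_bigr => j _.
  by rewrite mulr_sumr.
- rewrite exchange_big; apply: eq_bigr => j _ /=.
  rewrite /bilin !mulrA mulr_sumr; apply: eq_bigr => i _.
  by rewrite mulr_sumr.
- under eq_bigr do rewrite exchange_big.
  rewrite exchange_big; apply: eq_bigr => k _ /=.
  rewrite /bilin !mulrA mulr_sumr; apply: eq_bigr => i _.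
  by rewrite mulr_sumr.
Qed.

End TubeCurvature.

(** * Complex hyperbolic tubes *)

Section ComplexHyperbolic.
Context {R : realType} {n : nat}.
Variables (U : set 'rV[R]_n) (Phi : 'rV[R]_n -> R).
Variables (gam : 'I_n -> 'I_n -> 'I_n -> 'rV[R]_n -> R).
Variables (T : 'I_n -> 'I_n -> 'I_n -> 'rV[R]_n -> R).
Variables (D : 'I_n -> 'I_n -> 'I_n -> 'I_n -> 'rV[R]_n -> R).
Hypothesis oU : open U.
Hypothesis hT : third_derivatives U Phi T.
Hypothesis hgam : forall x, U x -> forall k i j,
  gam k i j x = gamma_of Phi T k i j x.
Hypothesis hD : forall x, U x -> forall m k i j,
  is_derive x (delta_mx 0 m) (gam k i j) (D m k i j x).
Hypothesis pH : forall x, U x -> posdef (hessian Phi x).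

(* The curvature is linear in D and quadratic in gam; the last two hypotheses
   give both parts the values they have on complex hyperbolic space, in the
   normalization where the holomorphic sectional curvature is -1. *)
Hypothesis hDH : forall x, U x -> forall m k i j, D m k i j x =
  2^-1 * ((k == i)%:R * hessian Phi x j m + (k == j)%:R * hessian Phi x i m).
Hypothesis hcomm : forall x, U x -> forall l i j k,
  \sum_m (gam l i m x * gam m j k x - gam l j m x * gam m i k x) =
  4^-1 * ((l == i)%:R * hessian Phi x j k - (l == j)%:R * hessian Phi x i k).

Lemma sum3_idx (F : 'I_(n + n) -> 'I_(n + n) -> 'I_(n + n) -> R) :
  let S a b c := \sum_i \sum_j \sum_k F (idx a i) (idx b j) (idx c k) in
  \sum_p \sum_q \sum_r F p q r =
  S false false false + S false false true +
  (S false true false + S false true true) +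
  (S true false false + S true false true +
  (S true true false + S true true true)).
Proof.
move=> S; rewrite sum_idx; congr (_ + _).
all: under eq_bigr => i _ do rewrite sum_idx; rewrite big_split.
all: congr (_ + _); rewrite -big_split; apply: eq_bigr => i _ /=.
all: by rewrite -big_split; apply: eq_bigr => j _; rewrite sum_idx.
Qed.

(** Under the two hypotheses on gam every component of the curvature tensor
    is a combination of deltas and entries of H, so the sums over the indices
    contract to values of the bilinear form H on the real and imaginary parts
    of X; the off-diagonal values cancel. *)
Lemma curvature_op_hyperbolic z X : tube U z ->
  curvature_op (tube_metric Phi) z X (cplx_J X) (cplx_J X) =
  - bilin (tube_metric Phi z) X X *: X.
Proof.
move=> Uz; have [sH _] := pH _ Uz.
apply: part_eq => d; apply/rowP => l; rewrite -!partE !mxE.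
set H := hessian Phi (lsubmx z).
pose s a b c : R := cplx_coef a false d * cplx_coef b c false
           + cplx_coef a true d * cplx_coef b c true.
have hS (a b c : bool) (u v w : 'rV[R]_(n + n)) : \sum_i \sum_j \sum_k
    riemann (tube_metric Phi) (idx d l) (idx c k) (idx a i) (idx b j) z *
    u 0 (idx a i) * v 0 (idx b j) * w 0 (idx c k) =
  (4^-1 * s a b c - 2^-1 * ((~~ b)%:R * cplx_coef a c d)) * part a u 0 l *
    bilin H (part b v) (part c w) +
  (2^-1 * ((~~ a)%:R * cplx_coef b c d) - 4^-1 * s a b c) * part b v 0 l *
    bilin H (part a u) (part c w) +
  (2^-1 * ((~~ a)%:R * cplx_coef b c d) - 2^-1 * ((~~ b)%:R * cplx_coef a c d))
    * part c w 0 l * bilin H (part a u) (part b v).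
  rewrite -(contract_delta _ _ _ _ _ _ _ _ sH).
  apply: eq_bigr => i _; apply: eq_bigr => j _; apply: eq_bigr => k _.
  rewrite !partE (riemann_tube U _ gam T D) // !hDH // hcomm // -/H /s.
  have sym p q : H p q = H q p by rewrite -[in LHS](sH : H^T = H) mxE.
  by rewrite (sym k i) (sym k j) (sym j i); ring.
rewrite sum3_idx !hS !part_cplx_J /= !partE bilin_tube -/H.
have opE (v : 'rV[R]_n) : (- v) 0 l = - v 0 l by rewrite mxE.
rewrite !opE !(bilinNl, bilinNr) (bilin_sym H (part true X) (part false X)) //.
by rewrite /s /cplx_coef {s hS}; case: d => /=; field.
Qed.

(** X and JX are orthogonal of the same norm, so the quotient defining the
    sectional curvature is -|X|^4 / |X|^4. *)
Lemma holo_sectional_hyperbolic : has_holo_sectional U Phi (-1).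
Proof.
move=> z X Uz X0; have [sH pos] := pH _ Uz.
rewrite /holo_sectional /sectional curvature_op_hyperbolic // bilinZl.
set q := bilin _ X X.
have qJ : bilin (tube_metric Phi z) (cplx_J X) (cplx_J X) = q.
  by rewrite /q !bilin_tube !part_cplx_J bilinNl bilinNr opprK addrC.
have XJ : bilin (tube_metric Phi z) X (cplx_J X) = 0.
  rewrite bilin_tube !part_cplx_J bilinNr.
  by rewrite (bilin_sym _ (part true X)) // addNr.
have q0 : q != 0.
  have nn v : 0 <= bilin (hessian Phi (lsubmx z)) v v.
    have [->|/pos/ltW//] := eqVneq v 0.
    by rewrite -[X in bilin _ X _](scale0r (0 : 'rV[R]_n)) bilinZl mul0r.
  rewrite gt_eqF // /q bilin_tube.
  have [l0|/pos l0] := eqVneq (part false X) 0; last first.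
    by rewrite ltr_wpDr.
  have [r0|/pos r0] := eqVneq (part true X) 0; last by rewrite ltr_wpDl.
  case/eqP: X0; apply: part_eq => -[]; rewrite ?l0 ?r0 /part.
    by apply/rowP => i; rewrite !mxE.
  by apply/rowP => i; rewrite !mxE.
by rewrite qJ XJ; field.
Qed.

End ComplexHyperbolic.

(** * The two domains and the two Hessian matrices *)

(** The set is the union of the segments from x0, which are connected and
    meet at x0. *)
Lemma connected_of_segments {R : realType} {n : nat} (U : set 'rV[R]_n) x0 :
  U x0 ->
  (forall y (t : R), U y -> 0 <= t <= 1 -> U (x0 + t *: (y - x0))) ->
  connected U.
Proof.
move=> Ux0 seg; pose path y (t : R) := x0 + t *: (y - x0).
have -> : U = \bigcup_(y in U) (path y @` `[0, 1]).
  apply/seteqP; split=> [y Uy|y [w Uw] [t]]; last first.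
    by rewrite /= in_itv /= => t01 <-; exact: seg.
  exists y => //; exists 1; first by rewrite /= in_itv /= ler01 lexx.
  by rewrite /path scale1r addrC subrK.
apply: bigcup_connected.
  exists x0 => y Uy; exists 0; first by rewrite /= in_itv /= ler01 lexx.
  by rewrite /path scale0r addr0.
move=> y Uy; apply: connected_continuous_connected.
  exact: segment_connected.
apply: continuous_subspaceT => t.
have lin : {for t, continuous (fun r : R => r *: (y - x0))}.
  by apply: continuousZr_tmp; exact: cvg_id.
apply: (@cvgD R _ _ _ _ (cst x0) (fun r : R => r *: (y - x0))); last exact: lin.
exact: cst_continuous.
Qed.

Section Planar.
Context {R : realType}.
Implicit Types (u v t x : 'rV[R]_2) (i j k l m : 'I_2).

Lemma ord2P i : i = 0 \/ i = 1.
Proof. by case: i => -[|[|//]] hi; [left|right]; apply: val_inj. Qed.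

Lemma sum_ord2 (F : 'I_2 -> R) : \sum_i F i = F 0 + F 1.
Proof.
by rewrite big_ord_recl big_ord1; congr (_ + F _); apply: val_inj.
Qed.

Lemma wsum_sqr_gt0 (a b : R) v : 0 < a -> 0 < b -> v != 0 ->
  0 < a * v 0 0 ^+ 2 + b * v 0 1 ^+ 2.
Proof.
move=> a0 b0 v0; have p0 := sqr_ge0 (v 0 0); have q0 := sqr_ge0 (v 0 1).
have [v00|v00] := eqVneq (v 0 0) 0; last first.
  have : 0 < v 0 0 ^+ 2 by rewrite exprn_even_gt0.
  by move=> /(mulr_gt0 a0); have := mulr_ge0 (ltW b0) q0; lra.
have : 0 < v 0 1 ^+ 2.
  rewrite exprn_even_gt0 //=; apply: contraNneq v0 => v01.
  by apply/eqP/rowP => i; rewrite mxE; case: (ord2P i) => ->.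
by move=> /(mulr_gt0 b0); have := mulr_ge0 (ltW a0) p0; lra.
Qed.

Definition total u : R := 1 + u 0 0 + u 0 1.

(** Covariance matrix of the negative trinomial law with mean u. *)
Definition covariance u : 'M[R]_2 :=
  \matrix_(i, j) ((i == j)%:R * u 0 i + u 0 i * u 0 j).

(** The inverse of the covariance matrix (see [mul_covariance_precision]). *)
Definition precision u : 'M[R]_2 :=
  \matrix_(i, j) ((i == j)%:R * (u 0 i)^-1 - (total u)^-1).

Lemma total_gt0 u : OmegaStar R u -> 0 < total u.
Proof. by case=> u0 u1; rewrite /total; lra. Qed.

Lemma OmegaStar_gt0 u i : OmegaStar R u -> 0 < u 0 i.
Proof. by case=> u0 u1; case: (ord2P i) => ->. Qed.

Ltac neq0 hu :=
  have := OmegaStar_gt0 _ 0 hu; have := OmegaStar_gt0 _ 1 hu;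
  have := total_gt0 _ hu; rewrite /total;
  let h1 := fresh in let h2 := fresh in let h3 := fresh in
  move=> h1 h2 h3; rewrite ?(gt_eqF h1) ?(gt_eqF h2) ?(gt_eqF h3) //.

Lemma mul_covariance_precision u : OmegaStar R u ->
  covariance u *m precision u = 1%:M.
Proof.
move=> hu; apply/matrixP => i j; rewrite !mxE sum_ord2 !mxE /total.
case: (ord2P i) => ->; case: (ord2P j) => -> /=; field; neq0 hu.
Qed.

Lemma posdef_covariance u : OmegaStar R u -> posdef (covariance u).
Proof.
move=> hu; split.
  apply/matrixP => i j; rewrite !mxE.
  by case: (ord2P i) => ->; case: (ord2P j) => -> /=; ring.
move=> v v0; have -> : bilin (covariance u) v v =
    u 0 0 * v 0 0 ^+ 2 + u 0 1 * v 0 1 ^+ 2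
    + (u 0 0 * v 0 0 + u 0 1 * v 0 1) ^+ 2.
  by rewrite /bilin !sum_ord2 !mxE /=; ring.
have [u0 u1] := hu; rewrite ltr_wpDr ?sqr_ge0 //.
by apply: wsum_sqr_gt0.
Qed.

(** Clearing the denominators s, u_1 and u_2 turns the quadratic form into a
    sum of squares with positive weights. *)
Lemma posdef_precision u : OmegaStar R u -> posdef (precision u).
Proof.
move=> hu; split.
  apply/matrixP => i j; rewrite !mxE.
  by case: (ord2P i) => ->; case: (ord2P j) => -> /=; ring.
move=> v v0; have [u0 u1] := hu; have s0 := total_gt0 _ hu.
have -> : bilin (precision u) v v =
    (u 0 1 * v 0 0 ^+ 2 + u 0 0 * v 0 1 ^+ 2
     + (u 0 1 * v 0 0 - u 0 0 * v 0 1) ^+ 2) / (total u * u 0 0 * u 0 1).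
  rewrite /bilin !sum_ord2 !mxE /= /total; field; neq0 hu.
rewrite divr_gt0 ?mulr_gt0 // ltr_wpDr ?sqr_ge0 //.
by apply: wsum_sqr_gt0.
Qed.

Lemma covariance_unit u : OmegaStar R u ->
  covariance u \in unitmx /\ invmx (covariance u) = precision u.
Proof.
move=> hu; have cp := mul_covariance_precision _ hu.
have [cu _] := mulmx1_unit cp; split=> //.
by rewrite -[LHS]mulmx1 -cp mulKmx.
Qed.

Lemma precision_unit u : OmegaStar R u ->
  precision u \in unitmx /\ invmx (precision u) = covariance u.
Proof.
move=> hu; have cp := mul_covariance_precision _ hu.
have [_ pu] := mulmx1_unit cp; split=> //.
by rewrite -[LHS]mul1mx -cp mulmxK.
Qed.

Lemma domain_OmegaStar : domain (OmegaStar R).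
Proof.
have h1 : OmegaStar R (const_mx 1) by split; rewrite mxE.
split; last by exists (const_mx 1).
  have -> : OmegaStar R = (fun u : 'rV[R]_2 => u 0 0) @^-1` [set r | 0 < r] `&`
      (fun u : 'rV[R]_2 => u 0 1) @^-1` [set r | 0 < r] by [].
  apply: openI; apply: open_comp => [x _|]; try exact: open_gt.
    exact: coord_continuous.
  exact: coord_continuous.
apply: (connected_of_segments _ _ h1) => y t [y0 y1] /andP[t0 t1].
by split; rewrite !mxE; nra.
Qed.

Lemma domain_Omega : domain (Omega R).
Proof.
have h1 : Omega R (const_mx (ln 4^-1)).
  by rewrite /Omega /= !mxE lnK ?posrE ?invr_gt0 //; lra.
split; last by exists (const_mx (ln 4^-1)).
  have -> : Omega R = (fun t : 'rV[R]_2 => expR (t 0 0) + expR (t 0 1)) @^-1`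
      [set r | r < 1] by [].
  apply: open_comp => [x _|]; last exact: open_lt.
  by apply: (elementary_continuous setT) => //; do 2!constructor; constructor.
apply: (connected_of_segments _ _ h1) => y t yO /andP[t0 t1].
move: h1 yO; rewrite /Omega /=; set x := const_mx _ => xO yO.
(* the tangent line of the exponential at an intermediate point *)
have conv i : expR ((x + t *: (y - x)) 0 i) <=
    (1 - t) * expR (x 0 i) + t * expR (y 0 i).
  set q := (x + _) 0 i.
  have qE : q = (1 - t) * x 0 i + t * y 0 i by rewrite /q !mxE; ring.
  have tan p : expR q * (1 + (p - q)) <= expR p.
    have := expR_ge1Dx (p - q); rewrite -(ler_pM2l (expR_gt0 q)) -expRD.
    by rewrite (addrC q (p - q)) subrK.
  have := tan (x 0 i); have := tan (y 0 i).
  have := expR_gt0 q; rewrite qE; nra.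
have := conv 0; have := conv 1.
move: xO yO; have [] := lerP (expR (x 0 0) + expR (x 0 1))
  (expR (y 0 0) + expR (y 0 1)); nra.
Qed.

End Planar.

(** * The negative trinomial potential *)

Section NegativeTrinomialTube.
Context {R : realType}.
Implicit Types (u v t x : 'rV[R]_2) (i j k l m : 'I_2).

Definition gap t : R := 1 - expR (t 0 0) - expR (t 0 1).

Definition mean t : 'rV[R]_2 := \row_i (expR (t 0 i) / gap t).

Definition natural_param u : 'rV[R]_2 := \row_i ln (u 0 i / total u).

Lemma gap_gt0 t : Omega R t -> 0 < gap t.
Proof. by rewrite /Omega /gap /=; lra. Qed.

Lemma mean_OmegaStar t : Omega R t -> OmegaStar R (mean t).
Proof.
by move=> /gap_gt0 g0; split; rewrite mxE divr_gt0 ?expR_gt0.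
Qed.

Lemma expR_natural_param u i : OmegaStar R u ->
  expR (natural_param u 0 i) = u 0 i / total u.
Proof.
by move=> hu; rewrite mxE lnK // posrE divr_gt0 ?total_gt0 ?OmegaStar_gt0.
Qed.

Lemma gap_natural_param u : OmegaStar R u -> gap (natural_param u) = (total u)^-1.
Proof.
move=> hu; rewrite /gap !expR_natural_param //; have := total_gt0 _ hu.
by rewrite /total => s0; field; rewrite gt_eqF.
Qed.

Lemma natural_param_Omega u : OmegaStar R u -> Omega R (natural_param u).
Proof.
move=> hu; have := gap_natural_param _ hu; have := total_gt0 _ hu.
by rewrite -invr_gt0 /Omega /gap /= => s0 e; rewrite -subr_gt0 opprD addrA e.
Qed.

Lemma natural_paramK u : OmegaStar R u -> mean (natural_param u) = u.
Proof.
move=> hu; apply/rowP => i; rewrite mxE expR_natural_param // gap_natural_param //.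
by rewrite invrK divfK // gt_eqF ?total_gt0.
Qed.

Lemma is_derive_exp_coord l i t :
  is_derive t (delta_mx 0 l) (fun x => expR (x 0 i))
    (expR (t 0 i) * (l == i)%:R).
Proof. exact/is_derive_chain/is_derive_coord. Qed.

Lemma is_derive_gap l t :
  is_derive t (delta_mx 0 l) gap (- expR (t 0 l)).
Proof.
have := is_derive_add _ _ _ _ _ _ (is_derive_add _ _ _ _ _ _
  (is_derive_const 1 t _) (is_derive_opp _ _ _ _ (is_derive_exp_coord l 0 t)))
  (is_derive_opp _ _ _ _ (is_derive_exp_coord l 1 t)).
by move=> /is_derive_eq; apply; case: (ord2P l) => -> /=; ring.
Qed.

Lemma partial_PhiNT l t : Omega R t -> partial l PhiNT t = mean t 0 l.
Proof.
move=> tO; have g0 := gap_gt0 _ tO; apply: partialE.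
have := is_derive_opp _ _ _ _
  (is_derive_chain _ _ _ _ _ _ (is_derive_gap l t) (is_derive1_ln g0)).
by move=> /is_derive_eq; apply; rewrite mxE; ring.
Qed.

(** The basic identity of the family: the mean satisfies a differential
    system with right-hand side polynomial in the mean itself.  All higher
    derivatives of the potential are computed from it by algebra. *)
Lemma is_derive_mean l i t : Omega R t ->
  is_derive t (delta_mx 0 l) (fun x => mean x 0 i) (covariance (mean t) l i).
Proof.
move=> tO; have g0 := gap_gt0 _ tO.
have -> : (fun x => mean x 0 i) = (fun x => expR (x 0 i) * (gap x)^-1).
  by apply/funext => x; rewrite mxE.
have := is_derive_mul _ _ _ _ _ _ (is_derive_exp_coord l i t)
  (is_derive_inv _ _ _ _ (lt0r_neq0 g0) (is_derive_gap l t)).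
move=> /is_derive_eq; apply; rewrite !mxE.
case: (ord2P l) => ->; case: (ord2P i) => -> /=; field; exact: lt0r_neq0.
Qed.

Lemma open_Omega : open (Omega R).
Proof. by case: (@domain_Omega R). Qed.

Lemma hessian_PhiNT t : Omega R t -> hessian PhiNT t = covariance (mean t).
Proof.
move=> tO; apply/matrixP => i j; rewrite mxE.
rewrite (partial_near _ _ (fun x => mean x 0 j) _ _ open_Omega) //.
  exact/partialE/is_derive_mean.
by move=> x xO; exact: partial_PhiNT.
Qed.

Lemma kahler_PhiNT : kahler_tube (Omega R) PhiNT.
Proof.
split; first exact: domain_Omega.
  apply: (elementary_smooth _ _ open_Omega).
  apply: ElemOpp; apply: (ElemLn _ gap); first exact: gap_gt0.
  by do ![apply: ElemAdd|apply: ElemOpp|apply: ElemExp|constructor].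
move=> t tO; rewrite hessian_PhiNT //; exact/posdef_covariance/mean_OmegaStar.
Qed.

Definition third_PhiNT l i j t : R :=
  (i == j)%:R * covariance (mean t) l i
  + covariance (mean t) l i * mean t 0 j + mean t 0 i * covariance (mean t) l j.

(** Raising an index with the precision matrix cancels the covariance matrices
    that occur in the third derivatives. *)
Definition gamma_PhiNT k i j t : R :=
  2^-1 * ((k == i)%:R * (i == j)%:R + (k == i)%:R * mean t 0 j
          + (k == j)%:R * mean t 0 i).

Definition dgamma_PhiNT l k i j t : R :=
  2^-1 * ((k == i)%:R * covariance (mean t) l j
          + (k == j)%:R * covariance (mean t) l i).

Lemma third_derivatives_PhiNT :
  third_derivatives (Omega R) PhiNT third_PhiNT.
Proof.
move=> t tO; have mS := mean_OmegaStar _ tO.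
split; first by rewrite hessian_PhiNT //; case: (covariance_unit _ mS).
- move=> l i j; apply: partialE.
  apply: (is_derive_near (Omega R)
    (fun x => (i == j)%:R * mean x 0 i + mean x 0 i * mean x 0 j)) => //.
  + exact: open_Omega.
  + by move=> x xO; rewrite hessian_PhiNT // [RHS]mxE.
  have hi := is_derive_mean l i _ tO; have hj := is_derive_mean l j _ tO.
  have := is_derive_add _ _ _ _ _ _
    (is_derive_mul _ _ _ _ _ _ (is_derive_const (i == j)%:R t _) hi)
    (is_derive_mul _ _ _ _ _ _ hi hj).
  by move=> /is_derive_eq; apply; rewrite /third_PhiNT; ring.
- move=> l i j; rewrite /third_PhiNT !mxE; move: (mean t) => w.
  by case: (ord2P l) => ->; case: (ord2P i) => ->; case: (ord2P j) => -> /=; ring.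
- move=> l i j; rewrite /third_PhiNT !mxE; move: (mean t) => w.
  by case: (ord2P l) => ->; case: (ord2P i) => ->; case: (ord2P j) => -> /=; ring.
Qed.

(** The conditions of [holo_sectional_hyperbolic] are polynomial identities
    in the mean. *)
Lemma holo_sectional_PhiNT : has_holo_sectional (Omega R) PhiNT (-1).
Proof.
apply: (holo_sectional_hyperbolic (Omega R) PhiNT gamma_PhiNT third_PhiNT
  dgamma_PhiNT open_Omega third_derivatives_PhiNT).
- move=> t tO k i j; have mS := mean_OmegaStar _ tO.
  have [_ inv] := covariance_unit _ mS.
  rewrite /gamma_PhiNT /gamma_of hessian_PhiNT // inv sum_ord2 /third_PhiNT.
  move: (mean t) mS {inv} => w mS; have := total_gt0 _ mS; have [] := mS.
  rewrite !mxE /total => /lt0r_neq0 w0 /lt0r_neq0 w1 /lt0r_neq0 s0.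
  by case: (ord2P k) => ->; case: (ord2P i) => ->; case: (ord2P j) => -> /=;
    field; rewrite ?w0 ?w1 ?s0.
- move=> t tO l k i j; have hi := is_derive_mean l i _ tO.
  have hj := is_derive_mean l j _ tO.
  have := is_derive_mul _ _ _ _ _ _ (is_derive_const 2^-1 t _)
   (is_derive_add _ _ _ _ _ _ (is_derive_add _ _ _ _ _ _
    (is_derive_const ((k == i)%:R * (i == j)%:R) t _)
    (is_derive_mul _ _ _ _ _ _ (is_derive_const (k == i)%:R t _) hj))
    (is_derive_mul _ _ _ _ _ _ (is_derive_const (k == j)%:R t _) hi)).
  by move=> /is_derive_eq; apply; rewrite /dgamma_PhiNT; ring.
- by have [] := kahler_PhiNT.
- move=> t tO l k i j; rewrite /dgamma_PhiNT hessian_PhiNT //.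
  have [sC _] := posdef_covariance _ (mean_OmegaStar _ tO).
  by rewrite -[in LHS]sC !mxE.
- move=> t tO l i j k; rewrite hessian_PhiNT // sum_ord2 /gamma_PhiNT.
  rewrite [covariance _ j k]mxE [covariance _ i k]mxE; move: (mean t) => w.
  by case: (ord2P l) => ->; case: (ord2P i) => ->; case: (ord2P j) => ->;
    case: (ord2P k) => -> /=; field.
Qed.

Lemma dual_domain_PhiNT : dual_domain (Omega R) PhiNT = OmegaStar R.
Proof.
have gradE t : Omega R t -> gradient PhiNT t = mean t.
  by move=> tO; apply/rowP => i; rewrite mxE partial_PhiNT.
apply/seteqP; split=> [_ [t tO <-]|u hu].
  by rewrite gradE //; exact: mean_OmegaStar.
have cO := natural_param_Omega _ hu.
by exists (natural_param u); rewrite ?gradE // natural_paramK.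
Qed.

(** Writing <t, u> - Phi(t) - Phi*(u) as
    sum_i u_i log (p_i s / u_i) + log ((1 - p_1 - p_2) s), with
    s = 1 + u_1 + u_2, the bound log x <= x - 1 gives a sum that vanishes; the
    point with mean u attains the bound. *)
Lemma legendre_PhiNT u : OmegaStar R u ->
  legendre (Omega R) PhiNT u = (PhiNTStar u)%:E.
Proof.
move=> hu; have [u0 u1] := hu; have s0 := total_gt0 _ hu.
have valE t : dotv t u - PhiNT t =
    t 0 0 * u 0 0 + t 0 1 * u 0 1 + ln (gap t).
  by rewrite /dotv sum_ord2 /PhiNT opprK.
apply/eqP; rewrite eq_le; apply/andP; split.
  apply: ge_ereal_sup => _ [t tO <-]; rewrite lee_fin valE.
  have g0 := gap_gt0 _ tO.
  have tangent (p q : R) : 0 < q -> 0 < p -> q * (ln p - ln q) <= p - q.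
    move=> q0 p0; rewrite -ln_div ?posrE //.
    have -> : p - q = q * (p / q - 1) by rewrite mulrBr mulr1 mulrCA divff ?mulr1 ?lt0r_neq0.
    rewrite ler_pM2l //; have := @le_ln1Dx R (p / q - 1).
    by rewrite [1 + _]addrC subrK; apply; have := divr_gt0 p0 q0; lra.
  have eS i : 0 < expR (t 0 i) * total u by rewrite mulr_gt0 ?expR_gt0.
  have := tangent _ _ u0 (eS 0); have := tangent _ _ u1 (eS 1).
  have := tangent _ _ ltr01 (mulr_gt0 g0 s0).
  rewrite !lnM ?posrE ?expR_gt0 // !expRK ln1 /PhiNTStar -[1 + _ + _]/(total u).
  set e0 := expR (t 0 0); set e1 := expR (t 0 1); set L := ln (total u).
  set G := ln (gap t).
  have -> : gap t = 1 - e0 - e1 by [].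
  have : total u = 1 + u 0 0 + u 0 1 by [].
  move: (total u) L G (ln _) (ln _) => s L' G' l0 l1 ->; nra.
apply: ereal_sup_ubound; exists (natural_param u); first exact: natural_param_Omega.
rewrite valE gap_natural_param // lnV ?posrE // !mxE !ln_div ?posrE //.
rewrite /PhiNTStar -[1 + _ + _]/(total u); congr (_%:E).
move: (ln (total u)) => L; rewrite /total; ring.
Qed.

End NegativeTrinomialTube.

(** * The statistical mirror *)

Section Mirror.
Context {R : realType}.
Implicit Types (u v x : 'rV[R]_2) (i j k l m : 'I_2).
(* P stands for the dual potential, which is given by the closed formula on
   the dual domain only. *)
Variable P : 'rV[R]_2 -> R.
Hypothesis PE : forall u, OmegaStar R u -> P u = PhiNTStar u.

Lemma open_OmegaStar : open (OmegaStar R).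
Proof. by case: (@domain_OmegaStar R). Qed.

Lemma is_derive_total l u : is_derive u (delta_mx 0 l) total 1.
Proof.
have := is_derive_add _ _ _ _ _ _ (is_derive_add _ _ _ _ _ _
  (is_derive_const 1 u _) (is_derive_coord l 0 u)) (is_derive_coord l 1 u).
by move=> /is_derive_eq; apply; case: (ord2P l) => -> /=; ring.
Qed.

Lemma partial_mirror l u : OmegaStar R u ->
  partial l P u = ln (u 0 l) - ln (total u).
Proof.
move=> hu; have s0 := total_gt0 _ hu.
rewrite (partial_near _ _ PhiNTStar _ _ open_OmegaStar) //; apply: partialE.
have hc i := is_derive_coord l i u.
have hent i := is_derive_mul _ _ _ _ _ _ (hc i)
  (is_derive_chain _ _ _ _ _ _ (hc i) (is_derive1_ln (OmegaStar_gt0 _ i hu))).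
have hs := is_derive_total l u.
have := is_derive_add _ _ _ _ _ _ (is_derive_add _ _ _ _ _ _ (hent 0) (hent 1))
  (is_derive_opp _ _ _ _ (is_derive_mul _ _ _ _ _ _ hs
    (is_derive_chain _ _ _ _ _ _ hs (is_derive1_ln s0)))).
have := lt0r_neq0 (OmegaStar_gt0 _ 0 hu); have := lt0r_neq0 (OmegaStar_gt0 _ 1 hu).
move: (lt0r_neq0 s0) => s1 u1 u0.
by move=> /is_derive_eq; apply; case: (ord2P l) => -> /=; field; rewrite ?s1 ?u0 ?u1.
Qed.

Lemma is_derive_precision l i j u : OmegaStar R u ->
  is_derive u (delta_mx 0 l)
    (fun x => (i == j)%:R * (x 0 i)^-1 - (total x)^-1)
    ((total u) ^- 2 - (l == i)%:R * (i == j)%:R * (u 0 i) ^- 2).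
Proof.
move=> hu; have s0 := lt0r_neq0 (total_gt0 _ hu).
have ui := lt0r_neq0 (OmegaStar_gt0 _ i hu).
have := is_derive_add _ _ _ _ _ _
  (is_derive_mul _ _ _ _ _ _ (is_derive_const (i == j)%:R u _)
    (is_derive_inv _ _ _ _ ui (is_derive_coord l i u)))
  (is_derive_opp _ _ _ _ (is_derive_inv _ _ _ _ s0 (is_derive_total l u))).
by move=> /is_derive_eq; apply; ring.
Qed.

Lemma hessian_mirror u : OmegaStar R u -> hessian P u = precision u.
Proof.
move=> hu; apply/matrixP => i j; rewrite !mxE.
rewrite (partial_near _ _ (fun x => ln (x 0 j) - ln (total x)) _ _
  open_OmegaStar) //; last by move=> x hx; exact: partial_mirror.
apply: partialE.
have := is_derive_add _ _ _ _ _ _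
  (is_derive_chain _ _ _ _ _ _ (is_derive_coord i j u)
    (is_derive1_ln (OmegaStar_gt0 _ j hu)))
  (is_derive_opp _ _ _ _ (is_derive_chain _ _ _ _ _ _ (is_derive_total i u)
    (is_derive1_ln (total_gt0 _ hu)))).
move=> /is_derive_eq; apply.
by case: (ord2P i) => ->; case: (ord2P j) => -> /=; ring.
Qed.

Lemma kahler_mirror : kahler_tube (OmegaStar R) P.
Proof.
split; first exact: domain_OmegaStar.
  apply: (smooth_on_eq _ PhiNTStar _ open_OmegaStar) => [u hu|].
    by rewrite PE.
  apply: (elementary_smooth _ _ open_OmegaStar).
  do ![apply: ElemAdd|apply: ElemOpp|apply: ElemMul|exact: ElemCoord
      |exact: ElemConst].
  - by apply: ElemLn; [move=> x [] | constructor].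
  - by apply: ElemLn; [move=> x [] | constructor].
  - apply: (ElemLn _ total); first exact: total_gt0.
    by do ![apply: ElemAdd|constructor].
move=> u hu; rewrite hessian_mirror //; exact: posdef_precision.
Qed.

Definition third_mirror l i j u : R :=
  (total u) ^- 2 - (l == i)%:R * (i == j)%:R * (u 0 i) ^- 2.

Definition gamma_mirror k i j u : R :=
  2^-1 * (u 0 k * (total u)^-1 -
    (i == j)%:R * ((k == i)%:R + u 0 k) * (u 0 i)^-1).

Definition dgamma_mirror l k i j u : R :=
  2^-1 * ((l == k)%:R * (total u)^-1 - u 0 k * (total u) ^- 2 -
    (i == j)%:R * ((l == k)%:R * (u 0 i)^-1 -
      (l == i)%:R * ((k == i)%:R + u 0 k) * (u 0 i) ^- 2)).

Lemma third_derivatives_mirror :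
  third_derivatives (OmegaStar R) P third_mirror.
Proof.
move=> u hu.
split; first by rewrite hessian_mirror //; case: (precision_unit _ hu).
- move=> l i j; apply: partialE.
  apply: (is_derive_near (OmegaStar R)
    (fun x => (i == j)%:R * (x 0 i)^-1 - (total x)^-1)) => //.
  + exact: open_OmegaStar.
  + by move=> x hx; rewrite hessian_mirror // mxE.
  exact: is_derive_precision.
- move=> l i j; rewrite /third_mirror.
  by case: (ord2P l) => ->; case: (ord2P i) => ->; case: (ord2P j) => -> /=; ring.
- move=> l i j; rewrite /third_mirror.
  by case: (ord2P l) => ->; case: (ord2P i) => ->; case: (ord2P j) => -> /=; ring.
Qed.

Lemma gamma_mirrorE u : OmegaStar R u -> forall k i j,
  gamma_mirror k i j u = gamma_of P third_mirror k i j u.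
Proof.
move=> hu k i j; have [_ inv] := precision_unit _ hu.
rewrite /gamma_mirror /gamma_of hessian_mirror // inv sum_ord2 /third_mirror !mxE.
have := total_gt0 _ hu; have [] := hu.
rewrite /total => /lt0r_neq0 u0 /lt0r_neq0 u1 /lt0r_neq0 s0.
by case: (ord2P k) => ->; case: (ord2P i) => ->; case: (ord2P j) => -> /=;
    field; rewrite ?u0 ?u1 ?s0.
Qed.

Lemma is_derive_gamma_mirror u : OmegaStar R u -> forall l k i j,
  is_derive u (delta_mx 0 l) (gamma_mirror k i j) (dgamma_mirror l k i j u).
Proof.
move=> hu l k i j; have s0 := lt0r_neq0 (total_gt0 _ hu).
have ui := lt0r_neq0 (OmegaStar_gt0 _ i hu).
have hk := is_derive_coord l k u; have hi := is_derive_coord l i u.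
have := is_derive_mul _ _ _ _ _ _ (is_derive_const 2^-1 u _)
  (is_derive_add _ _ _ _ _ _
    (is_derive_mul _ _ _ _ _ _ hk
      (is_derive_inv _ _ _ _ s0 (is_derive_total l u)))
    (is_derive_opp _ _ _ _ (is_derive_mul _ _ _ _ _ _
      (is_derive_mul _ _ _ _ _ _ (is_derive_const (i == j)%:R u _)
        (is_derive_add _ _ _ _ _ _ (is_derive_const (k == i)%:R u _) hk))
      (is_derive_inv _ _ _ _ ui hi)))).
by move=> /is_derive_eq; apply; rewrite /dgamma_mirror; ring.
Qed.

(** The precision matrix has determinant 1 / (s u_1 u_2), so minus the Hessian
    of its logarithm has entries -1/s^2 - delta_ij / u_i^2; the formula is its
    trace against the covariance matrix. *)
Lemma scalar_mirror (z : 'rV[R]_(2 + 2)) : tube (OmegaStar R) z ->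
  let u := lsubmx z in
  tube_scalar P z = - (3 - (total u)^-1 + (u 0 0)^-1 + (u 0 1)^-1).
Proof.
move=> hz u; have hu : OmegaStar R u := hz.
rewrite (tube_scalarE (OmegaStar R) P gamma_mirror third_mirror dgamma_mirror
  open_OmegaStar third_derivatives_mirror gamma_mirrorE is_derive_gamma_mirror) //.
rewrite -/u hessian_mirror //; have [_ ->] := precision_unit _ hu.
move: u hu {hz} => u hu.
rewrite !sum_ord2 /dgamma_mirror !mxE; have := total_gt0 _ hu; have [] := hu.
rewrite /total => /lt0r_neq0 u0 /lt0r_neq0 u1 /lt0r_neq0 s0 /=.
by field; rewrite ?u0 ?u1 ?s0.
Qed.

Lemma scalar_mirror_lt0 (z : 'rV[R]_(2 + 2)) :
  tube (OmegaStar R) z -> tube_scalar P z < 0.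
Proof.
move=> hz; rewrite scalar_mirror // oppr_lt0.
have [u0 u1] := hz.
have s1 : 1 < total (lsubmx z) by rewrite /total; lra.
have : (total (lsubmx z))^-1 < 1 by rewrite invf_lt1 //; lra.
move: u0 u1; rewrite -!(invr_gt0 (lsubmx z _ _)); lra.
Qed.

Lemma scalar_mirror_not_const : ~ has_const_scalar (OmegaStar R) P.
Proof.
case=> c hc; have at_diag (r : R) : 0 < r ->
    - (3 - (1 + r + r)^-1 + r^-1 + r^-1) = c.
  move=> r0; have hz : tube (OmegaStar R) (row_mx (const_mx r) 0 : 'rV[R]_(2 + 2)).
    by rewrite /tube /= row_mxKl; split; rewrite mxE.
  by rewrite -(hc _ hz) scalar_mirror // /total row_mxKl !mxE.
(* 13/15 is the difference of the values at (1, 1) and (2, 2) *)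
have : 3 - (1 + 1 + 1)^-1 + 1^-1 + 1^-1 =
    3 - (1 + 2 + 2)^-1 + 2^-1 + 2^-1 + 13 / 15 :> R by field.
have := at_diag 1 ltr01; have := at_diag 2 (ltr0Sn R 1); lra.
Qed.

End Mirror.

(** * The theorem *)

Theorem mainTheorem6 (R : realType) :
  let UStar : set 'rV[R]_2 := dual_domain (Omega R) PhiNT in
  let PStar : 'rV[R]_2 -> R := dual_potential (Omega R) PhiNT in
  (* the mirror of a tube of constant holomorphic sectional curvature
     need not have constant scalar curvature *)
  (exists (n : nat) (U : set 'rV[R]_n) (Phi : 'rV[R]_n -> R),
     [/\ kahler_tube U Phi,
         exists c : R, has_holo_sectional U Phi c,
         kahler_tube (dual_domain U Phi) (dual_potential U Phi)
       & ~ has_const_scalar (dual_domain U Phi) (dual_potential U Phi)]) /\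
  (* the negative trinomial potential and its Legendre dual *)
  [/\ kahler_tube (Omega R) PhiNT,
      UStar = OmegaStar R,
      (forall u : 'rV[R]_2, OmegaStar R u ->
         legendre (Omega R) PhiNT u = (PhiNTStar u)%:E)
    & kahler_tube UStar PStar] /\
  (* curvature of the tube and of its statistical mirror *)
  [/\ exists2 c : R, c < 0 & has_holo_sectional (Omega R) PhiNT c,
      (forall z : 'rV[R]_(2 + 2), tube UStar z -> tube_scalar PStar z < 0)
    & ~ has_const_scalar UStar PStar].
Proof.
move=> UStar PStar.
have US : UStar = OmegaStar R := dual_domain_PhiNT.
have PE u : OmegaStar R u -> PStar u = PhiNTStar u.
  by move=> hu; rewrite /PStar /dual_potential legendre_PhiNT.
have kM : kahler_tube UStar PStar by rewrite US; exact: kahler_mirror.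
have nc : ~ has_const_scalar UStar PStar.
  by rewrite US; exact: scalar_mirror_not_const.
split.
  exists 2, (Omega R), PhiNT; split=> //; first exact: kahler_PhiNT.
  by exists (-1); exact: holo_sectional_PhiNT.
split; first by split; [exact: kahler_PhiNT|exact: US|exact: legendre_PhiNT|].
split=> //; first by exists (-1); [lra|exact: holo_sectional_PhiNT].
by rewrite US; exact: scalar_mirror_lt0.
Qed.
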